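(* The warped product manifold $\mathbb{R}_{>0}\times_r\mathfrak{H}$ does not admit any isometric minimal immersion into any complex hyperbolic space $\mathbf{H}^n_{\mathbb{C}}$.
   Context: $\mathfrak{H}=\mathbb{C}\times\mathbb{R}$ is the Heisenberg group with coordinates $(z=x+iy,t)$ and multiplication $(z,t)*(w,s)=(z+w,t+s+2\Im(z\overline w))$, endowed with the Riemannian metric $g=dx^2+dy^2+\tfrac14\omega^2$, where $\omega=dt+2x\,dy-2y\,dx$. The warped product $\mathbb{R}_{>0}\times_r\mathfrak{H}$ (the Riemannian cone of $\mathfrak{H}$) is $\mathbb{R}_{>0}\times\mathfrak{H}$ with the metric $dr^2+r^2g$. $\mathbf{H}^n_{\mathbb{C}}$ is the complex hyperbolic $n$-space with constant holomorphic sectional curvature $-4$. A minimal immersion is one with vanishing mean curvature vector. *)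

(* Defs.v *)
From HB Require Import structures.
From mathcomp Require Import all_boot all_order all_algebra.
From mathcomp Require Import all_classical all_reals all_analysis.
Set Implicit Arguments.
Unset Strict Implicit.
Unset Printing Implicit Defensive.
Import Order.TTheory GRing.Theory Num.Theory numFieldNormedType.Exports.
Local Open Scope classical_set_scope.
Local Open Scope ring_scope.

(* Both manifolds of interest are open subsets of some R^m with a global
   chart, so Riemannian geometry is done in coordinates: points and tangent
   vectors are row vectors, and maps between manifolds are total functions
   whose values off the open set under consideration are irrelevant. *)

Section Coordinates.
Variable R : realType.

Definition partial (m : nat) (V : normedModType R) (i : 'I_m)
  (f : 'rV[R]_m -> V) (x : 'rV[R]_m) : V := 'D_(delta_mx 0 i) f x.

(* Class C^k on an open set U. *)
Fixpoint Ck (k m : nat) (V : normedModType R) (U : set 'rV[R]_m)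
    (f : 'rV[R]_m -> V) : Prop :=
  if k is k'.+1 then
    (forall x, U x -> differentiable f x) /\
    (forall v : 'rV[R]_m, Ck k' U (fun x => 'D_v f x))
  else forall x, U x -> {for x, continuous f}.

Definition smooth (m : nat) (V : normedModType R) (U : set 'rV[R]_m)
  (f : 'rV[R]_m -> V) : Prop := forall k, Ck k U f.

(* [G x u v] is the inner product of the tangent vectors u and v at x. *)
Definition metric (m : nat) := 'rV[R]_m -> 'rV[R]_m -> 'rV[R]_m -> R.

Definition metric_mx (m : nat) (G : metric m) (x : 'rV[R]_m) : 'M[R]_m :=
  \matrix_(i, j) G x (delta_mx 0 i) (delta_mx 0 j).

(* Gamma^k_{ij}, for the Levi-Civita connection of G. *)
Definition christoffel (m : nat) (G : metric m) (x : 'rV[R]_m)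
    (k i j : 'I_m) : R :=
  2^-1 * \sum_l invmx (metric_mx G x) k l *
    (partial i (fun y => metric_mx G y j l) x
     + partial j (fun y => metric_mx G y i l) x
     - partial l (fun y => metric_mx G y i j) x).

Section Immersions.
Variables (m N : nat) (h : metric N) (f : 'rV[R]_m -> 'rV[R]_N).
Implicit Type p : 'rV[R]_m.

Definition immersion (U : set 'rV[R]_m) : Prop :=
  smooth U f /\ forall p, U p -> injective (fun v : 'rV[R]_m => 'D_v f p).

Definition isometric_immersion (U : set 'rV[R]_m) (G : metric m) : Prop :=
  immersion U /\
  forall p, U p -> forall u v : 'rV[R]_m, h (f p) ('D_u f p) ('D_v f p) = G p u v.

Definition first_form p : 'M[R]_m :=
  \matrix_(i, j) h (f p) (partial i f p) (partial j f p).

(* Covariant derivative along d/dx_i of the vector field df(d/dx_j) along f,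
   for the Levi-Civita connection of h. *)
Definition cov_partial (i j : 'I_m) p : 'rV[R]_N :=
  partial i (partial j f) p
  + \row_a \sum_b \sum_c
      christoffel h (f p) a b c * partial i f p 0 b * partial j f p 0 c.

Definition normal_part p (w : 'rV[R]_N) : 'rV[R]_N :=
  w - \sum_k \sum_l
        (invmx (first_form p) k l * h (f p) w (partial l f p)) *: partial k f p.

Definition second_form (i j : 'I_m) p : 'rV[R]_N :=
  normal_part p (cov_partial i j p).

Definition mean_curvature p : 'rV[R]_N :=
  m%:R^-1 *: \sum_i \sum_j invmx (first_form p) i j *: second_form i j p.

Definition minimal (U : set 'rV[R]_m) : Prop :=
  forall p, U p -> mean_curvature p = 0.

End Immersions.

(* Coordinates (x, y, t) on the Heisenberg group; omega = dt + 2 x dy - 2 y dx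
   and the metric is dx^2 + dy^2 + omega^2 / 4. *)

Definition heis_omega (q u : 'rV[R]_3) : R :=
  u 0 2 + 2 * q 0 0 * u 0 1 - 2 * q 0 1 * u 0 0.

Definition heis_metric : metric 3 := fun q u v =>
  u 0 0 * v 0 0 + u 0 1 * v 0 1 + 4^-1 * (heis_omega q u * heis_omega q v).

(* The warped product of the positive half-line with (R^m, G): coordinates
   (r, q), metric dr^2 + r^2 G. *)

Definition cone_domain (m : nat) : set 'rV[R]_(1 + m) :=
  [set p | 0 < lsubmx p 0 0].

Definition cone_metric (m : nat) (G : metric m) : metric (1 + m) := fun p u v =>
  lsubmx u 0 0 * lsubmx v 0 0
  + lsubmx p 0 0 ^+ 2 * G (rsubmx p) (rsubmx u) (rsubmx v).

(* C^n is identified with R^(n+n): the first n coordinates are the real parts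
   and the last n the imaginary parts. [re_herm] and [im_herm] are the real and
   imaginary parts of the Hermitian product \sum_j u_j * conj v_j. *)

Definition re_herm (n : nat) (u v : 'rV[R]_(n + n)) : R :=
  \sum_(j < n) (lsubmx u 0 j * lsubmx v 0 j + rsubmx u 0 j * rsubmx v 0 j).

Definition im_herm (n : nat) (u v : 'rV[R]_(n + n)) : R :=
  \sum_(j < n) (rsubmx u 0 j * lsubmx v 0 j - lsubmx u 0 j * rsubmx v 0 j).

(* Unit ball model of complex hyperbolic n-space: the Bergman metric
     ds^2 = ((1 - |z|^2) |dz|^2 + |<dz, z>|^2) / (1 - |z|^2)^2,
   normalized so that the holomorphic sectional curvature is -4; for n = 1 it
   is the metric |dz|^2 / (1 - |z|^2)^2, of curvature -4, on the disc. *)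

Definition complex_ball (n : nat) : set 'rV[R]_(n + n) :=
  [set z | re_herm z z < 1].

Definition complex_hyperbolic_metric (n : nat) : metric (n + n) := fun z u v =>
  ((1 - re_herm z z) * re_herm u v
   + (re_herm u z * re_herm v z + im_herm u z * im_herm v z))
  / (1 - re_herm z z) ^+ 2.

End Coordinates.

Arguments heis_metric {R}.
Arguments cone_domain {R} m.
Arguments complex_ball {R} n.
Arguments complex_hyperbolic_metric {R} n.

(* Main.v *)
Require Import Defs.
From HB Require Import structures.
From mathcomp Require Import all_boot all_order all_algebra.
From mathcomp Require Import all_classical all_reals all_analysis.
From mathcomp Require Import ring lra.
Set Implicit Arguments.
Unset Strict Implicit.
Unset Printing Implicit Defensive.
Import Order.TTheory GRing.Theory Num.Theory numFieldNormedType.Exports.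
Local Open Scope classical_set_scope.
Local Open Scope ring_scope.

(** In a cone dr^2 + r^2 G every plane containing the radial direction is flat,
so the Ricci curvature of the cone vanishes in the radial direction.  Complex
hyperbolic space has sectional curvatures at most -1, and by the Gauss equation
a minimal submanifold has Ricci curvature at most that inherited from the
ambient space; here this would be at most -3 in the radial direction.

The Gauss equation is not developed in general.  Write X_i for the coordinate
fields along f, D for the pullback of the Levi-Civita connection, h for the
metric of the ball, and 0 for the index of the radial coordinate r.

- In the ball the Levi-Civita connection is explicit: with s = 1 - |z|^2 and <,>
  the Hermitian product, its correction to the flat derivative is the complex
  vector (<u,z> v + <v,z> u) / s.  This is [bergman_conn]; it is compatible with
  h ([is_derive_ch_metric]), it reproduces the Christoffel symbols
  ([christoffel_ch_metric]), and its curvature is an algebraic identity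
  ([bergman_curvature], [bergman_sectional_curvature]).
- Differentiating the coefficients of the cone metric once gives, on the whole
  cone, h(D_0 X_0, X_k) = 0 for every k and h(D_k X_0, X_k) = r G_kk for the
  transverse k.  Differentiating these along X_k and X_0 respectively and
  subtracting brings in the curvature of the plane of X_0 and X_k, and
  h(D_0 X_0, D_k X_k) >= h(X_k, X_k) follows ([radial_curvature_bound],
  [cone_radial_gauss]).
- By minimality the trace of D_i X_i over an orthogonal frame is tangent, hence
  orthogonal to D_0 X_0 ([minimal_trace]).  At the point r = 1 over the origin of
  the Heisenberg group the coordinate frame is orthogonal, and the trace reads
  0 = h(D_0 X_0, D_0 X_0) + (a sum of three terms, each at least 1).

Second derivatives along f must commute for this; [Ck_derive_comm] is Schwarz's
theorem for directional derivatives. *)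

(** * The Hermitian product and the Bergman metric *)

Definition mul_i (R : realType) (n : nat) (u : 'rV[R]_(n + n)) : 'rV[R]_(n + n) :=
  row_mx (- rsubmx u) (lsubmx u).

Lemma mul_iD (R : realType) n (u v : 'rV[R]_(n + n)) :
  mul_i (u + v) = mul_i u + mul_i v.
Proof. by rewrite /mul_i !linearD /= add_row_mx. Qed.

Lemma mul_iZ (R : realType) n (a : R) (u : 'rV[R]_(n + n)) :
  mul_i (a *: u) = a *: mul_i u.
Proof. by rewrite /mul_i !linearZ /= scale_row_mx scalerN. Qed.

Lemma mul_iK (R : realType) n (u : 'rV[R]_(n + n)) : mul_i (mul_i u) = - u.
Proof.
by rewrite /mul_i row_mxKr row_mxKl -opp_row_mx hsubmxK.
Qed.

Lemma re_hermC (R : realType) n (u v : 'rV[R]_(n + n)) :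
  re_herm u v = re_herm v u.
Proof. by apply: eq_bigr => j _; ring. Qed.

Lemma im_hermC (R : realType) n (u v : 'rV[R]_(n + n)) :
  im_herm u v = - im_herm v u.
Proof. by rewrite /im_herm -sumrN; apply: eq_bigr => j _; ring. Qed.

Lemma re_hermDl (R : realType) n (u v w : 'rV[R]_(n + n)) :
  re_herm (u + v) w = re_herm u w + re_herm v w.
Proof. by rewrite /re_herm -big_split /=; apply: eq_bigr => j _; rewrite !mxE; ring. Qed.

Lemma im_hermDl (R : realType) n (u v w : 'rV[R]_(n + n)) :
  im_herm (u + v) w = im_herm u w + im_herm v w.
Proof. by rewrite /im_herm -big_split /=; apply: eq_bigr => j _; rewrite !mxE; ring. Qed.

Lemma re_hermZl (R : realType) n (a : R) (u v : 'rV[R]_(n + n)) :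
  re_herm (a *: u) v = a * re_herm u v.
Proof. by rewrite /re_herm mulr_sumr; apply: eq_bigr => j _; rewrite !mxE; ring. Qed.

Lemma im_hermZl (R : realType) n (a : R) (u v : 'rV[R]_(n + n)) :
  im_herm (a *: u) v = a * im_herm u v.
Proof. by rewrite /im_herm mulr_sumr; apply: eq_bigr => j _; rewrite !mxE; ring. Qed.

Lemma re_herm_mul_il (R : realType) n (u v : 'rV[R]_(n + n)) :
  re_herm (mul_i u) v = - im_herm u v.
Proof.
rewrite /re_herm /im_herm -sumrN /mul_i row_mxKr row_mxKl.
by apply: eq_bigr => j _; rewrite !mxE; ring.
Qed.

Lemma im_herm_mul_il (R : realType) n (u v : 'rV[R]_(n + n)) :
  im_herm (mul_i u) v = re_herm u v.
Proof.
rewrite /re_herm /im_herm /mul_i row_mxKr row_mxKl.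
by apply: eq_bigr => j _; rewrite !mxE; ring.
Qed.

Lemma re_hermDr (R : realType) n (u v w : 'rV[R]_(n + n)) :
  re_herm w (u + v) = re_herm w u + re_herm w v.
Proof. by rewrite re_hermC re_hermDl !(re_hermC w). Qed.

Lemma im_hermDr (R : realType) n (u v w : 'rV[R]_(n + n)) :
  im_herm w (u + v) = im_herm w u + im_herm w v.
Proof. by rewrite im_hermC im_hermDl opprD -!(im_hermC w). Qed.

Lemma re_hermZr (R : realType) n (a : R) (u v : 'rV[R]_(n + n)) :
  re_herm v (a *: u) = a * re_herm v u.
Proof. by rewrite re_hermC re_hermZl (re_hermC v). Qed.

Lemma im_hermZr (R : realType) n (a : R) (u v : 'rV[R]_(n + n)) :
  im_herm v (a *: u) = a * im_herm v u.
Proof. by rewrite im_hermC im_hermZl -mulrN -(im_hermC v). Qed.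

Lemma re_herm_mul_ir (R : realType) n (u v : 'rV[R]_(n + n)) :
  re_herm v (mul_i u) = im_herm v u.
Proof. by rewrite re_hermC re_herm_mul_il -im_hermC. Qed.

Lemma im_herm_mul_ir (R : realType) n (u v : 'rV[R]_(n + n)) :
  im_herm v (mul_i u) = - re_herm v u.
Proof. by rewrite im_hermC im_herm_mul_il re_hermC. Qed.

Lemma im_herm_diag (R : realType) n (u : 'rV[R]_(n + n)) : im_herm u u = 0.
Proof. by apply: big1 => j _; ring. Qed.

Definition hermE := (re_hermDl, im_hermDl, re_hermZl, im_hermZl,
  re_hermDr, im_hermDr, re_hermZr, im_hermZr,
  re_herm_mul_il, im_herm_mul_il, re_herm_mul_ir, im_herm_mul_ir).

Lemma re_herm_ge0 (R : realType) n (u : 'rV[R]_(n + n)) : 0 <= re_herm u u.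
Proof. by apply: sumr_ge0 => j _; rewrite -!expr2 addr_ge0 ?sqr_ge0. Qed.

Lemma re_herm_eq0 (R : realType) n (u : 'rV[R]_(n + n)) :
  re_herm u u = 0 -> u = 0.
Proof.
move=> /eqP; rewrite psumr_eq0 => [/allP u0|j _]; last first.
  by rewrite -!expr2 addr_ge0 ?sqr_ge0.
have {}u0 j : lsubmx u 0 j = 0 /\ rsubmx u 0 j = 0.
  have := u0 j (mem_index_enum _); rewrite /= -!expr2.
  by rewrite paddr_eq0 ?sqr_ge0// !sqrf_eq0 => /andP[/eqP ? /eqP ?].
rewrite -[u]hsubmxK.
suff [-> ->] : lsubmx u = 0 /\ rsubmx u = 0 by rewrite row_mx0.
by split; apply/rowP => j; rewrite (proj1 (u0 j), proj2 (u0 j)) [RHS]mxE.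
Qed.

Lemma ch_metricC (R : realType) n (z u v : 'rV[R]_(n + n)) :
  complex_hyperbolic_metric n z u v = complex_hyperbolic_metric n z v u.
Proof. by rewrite /complex_hyperbolic_metric (re_hermC u v); congr (_ / _); ring. Qed.

Lemma ch_metricDl (R : realType) n (z u v w : 'rV[R]_(n + n)) :
  complex_hyperbolic_metric n z (u + v) w =
  complex_hyperbolic_metric n z u w + complex_hyperbolic_metric n z v w.
Proof. by rewrite /complex_hyperbolic_metric !hermE; ring. Qed.

Lemma ch_metricZl (R : realType) n (a : R) (z u v : 'rV[R]_(n + n)) :
  complex_hyperbolic_metric n z (a *: u) v =
  a * complex_hyperbolic_metric n z u v.
Proof. by rewrite /complex_hyperbolic_metric !hermE; ring. Qed.

Lemma ch_metricNl (R : realType) n (z u v : 'rV[R]_(n + n)) :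
  complex_hyperbolic_metric n z (- u) v = - complex_hyperbolic_metric n z u v.
Proof. by rewrite -scaleN1r ch_metricZl mulN1r. Qed.

Lemma ch_metricDr (R : realType) n (z u v w : 'rV[R]_(n + n)) :
  complex_hyperbolic_metric n z w (u + v) =
  complex_hyperbolic_metric n z w u + complex_hyperbolic_metric n z w v.
Proof. by rewrite /complex_hyperbolic_metric !hermE; ring. Qed.

Lemma ch_metricZr (R : realType) n (a : R) (z u v : 'rV[R]_(n + n)) :
  complex_hyperbolic_metric n z v (a *: u) =
  a * complex_hyperbolic_metric n z v u.
Proof. by rewrite /complex_hyperbolic_metric !hermE; ring. Qed.

Lemma ch_metricNr (R : realType) n (z u v : 'rV[R]_(n + n)) :
  complex_hyperbolic_metric n z v (- u) = - complex_hyperbolic_metric n z v u.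
Proof. by rewrite -scaleN1r ch_metricZr mulN1r. Qed.

Lemma ch_metric_sumr (R : realType) n (I : Type) (r : seq I) (P : pred I)
    (F : I -> 'rV[R]_(n + n)) (z u : 'rV[R]_(n + n)) :
  complex_hyperbolic_metric n z u (\sum_(i <- r | P i) F i) =
  \sum_(i <- r | P i) complex_hyperbolic_metric n z u (F i).
Proof.
elim/big_rec2: _ => [|i a b _ <-]; last by rewrite ch_metricDr.
by rewrite -(scale0r 0) ch_metricZr mul0r.
Qed.

Lemma ch_metric_ge0 (R : realType) n (z u : 'rV[R]_(n + n)) :
  complex_ball n z -> 0 <= complex_hyperbolic_metric n z u u.
Proof.
rewrite /complex_ball /= => z1; apply: divr_ge0; last exact: sqr_ge0.
apply: addr_ge0; first by rewrite mulr_ge0 ?re_herm_ge0 ?subr_ge0 1?ltW.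
by rewrite -!expr2 addr_ge0 ?sqr_ge0.
Qed.

Lemma ch_metric_eq0 (R : realType) n (z u : 'rV[R]_(n + n)) :
  complex_ball n z -> complex_hyperbolic_metric n z u u = 0 -> u = 0.
Proof.
rewrite /complex_ball /= => z1 /eqP.
have s0 : 0 < 1 - re_herm z z by rewrite subr_gt0.
rewrite mulf_eq0 invr_eq0 sqrf_eq0 (gt_eqF s0) orbF.
have n1 : 0 <= (1 - re_herm z z) * re_herm u u.
  by rewrite mulr_ge0 ?re_herm_ge0 ?ltW.
have n2 : 0 <= re_herm u z * re_herm u z + im_herm u z * im_herm u z.
  by rewrite -!expr2 addr_ge0 ?sqr_ge0.
by rewrite (paddr_eq0 n1 n2) mulf_eq0 (gt_eqF s0) => /andP[/eqP /re_herm_eq0].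
Qed.

(** On C^n this is the correction term (<u,z> v + <v,z> u) / (1 - |z|^2), with
complex scalars a + ib acting as a + b [mul_i]. *)
Definition bergman_conn (R : realType) n (z u v : 'rV[R]_(n + n)) :
    'rV[R]_(n + n) :=
  (1 - re_herm z z)^-1 *:
    (re_herm u z *: v + im_herm u z *: mul_i v
     + (re_herm v z *: u + im_herm v z *: mul_i u)).

Lemma bergman_connC (R : realType) n (z u v : 'rV[R]_(n + n)) :
  bergman_conn z u v = bergman_conn z v u.
Proof. by rewrite /bergman_conn [X in _ *: X]addrC. Qed.

Lemma linear_row_sum (R : realType) m (V : lmodType R) (f : 'rV[R]_m -> V) :
  linear f -> forall w, f w = \sum_b w 0 b *: f (delta_mx 0 b).
Proof.
move=> lf w; pose L := GRing.isLinear.Build _ _ _ _ _ lf.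
pose B : {linear _ -> _} := HB.pack f L.
rewrite -[f w]/(B w) [in LHS](row_sum_delta w) linear_sum.
by apply: eq_bigr => b _; rewrite linearZ.
Qed.

Lemma bergman_conn_linear (R : realType) n (z v : 'rV[R]_(n + n)) :
  linear (bergman_conn z ^~ v).
Proof.
move=> k w1 w2; rewrite /bergman_conn !hermE mul_iD mul_iZ.
by apply/rowP => j; rewrite !mxE; ring.
Qed.

Lemma bergman_conn_sum (R : realType) n (z u v : 'rV[R]_(n + n)) a :
  \sum_b \sum_c bergman_conn z (delta_mx 0 b) (delta_mx 0 c) 0 a * u 0 b * v 0 c =
  bergman_conn z u v 0 a.
Proof.
rewrite (linear_row_sum (bergman_conn_linear z v)) summxE.
apply: eq_bigr => b _; rewrite [in RHS]mxE bergman_connC.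
rewrite (linear_row_sum (bergman_conn_linear z _)) summxE mulr_sumr.
by apply: eq_bigr => c _; rewrite [in RHS]mxE (bergman_connC z (delta_mx 0 c)); ring.
Qed.

(** * Derivatives along a map into the ball *)

Lemma is_derive_entry (R : realType) (V : normedModType R) (m k : nat)
    (f : V -> 'M[R]_(m, k)) (df : 'M[R]_(m, k)) x v i j :
  is_derive x v f df -> is_derive x v (fun y => f y i j) (df i j).
Proof.
move=> [fd <-]; apply: DeriveDef; first exact: (derivable_mxP _ _ _).1.
by rewrite derive_mx// mxE.
Qed.

Lemma is_derive_mx (R : realType) (V : normedModType R) (m k : nat)
    (f : V -> 'M[R]_(m, k)) (df : 'M[R]_(m, k)) x v :
  (forall i j, is_derive x v (fun y => f y i j) (df i j)) -> is_derive x v f df.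
Proof.
move=> fd; have fx : derivable f x v by apply/derivable_mxP => i j; case: (fd i j).
apply: DeriveDef => //; rewrite derive_mx//; apply/matrixP => i j.
by rewrite mxE; case: (fd i j).
Qed.

Lemma is_derive_add (R : realType) (V W : normedModType R) (f g : V -> W) df dg x v :
  is_derive x v f df -> is_derive x v g dg ->
  is_derive x v (fun y => f y + g y) (df + dg).
Proof. by move=> fd gd; exact: is_deriveD. Qed.

Lemma is_derive_mul (R : realType) (V : normedModType R) (f g : V -> R) df dg x v :
  is_derive x v f df -> is_derive x v g dg ->
  is_derive x v (fun y => f y * g y) (df * g x + f x * dg).
Proof.
move=> fd gd; apply: (is_derive_eq (is_deriveM fd gd)).
by rewrite addrC [_ *: df]mulrC.
Qed.

Lemma is_derive_opp (R : realType) (V W : normedModType R) (f : V -> W) df x v :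
  is_derive x v f df -> is_derive x v (fun y => - f y) (- df).
Proof. by move=> fd; exact: is_deriveN. Qed.

Lemma is_derive_inv (R : realType) (V : normedModType R) (f : V -> R) df x v :
  f x != 0 -> is_derive x v f df ->
  is_derive x v (fun y => (f y)^-1) (- df / f x ^+ 2).
Proof.
move=> fx0 [fd <-]; apply: DeriveDef; first exact: derivableV.
by rewrite deriveV// [_ *: _]mulrC mulrN mulNr.
Qed.

Lemma is_derive_big (R : realType) (V W : normedModType R) n
    (f : 'I_n -> V -> W) df x v :
  (forall i, is_derive x v (f i) (df i)) ->
  is_derive x v (fun y => \sum_i f i y) (\sum_i df i).
Proof.
move=> fd; rewrite [X in is_derive _ _ X _](_ : _ = \sum_i f i); last first.
  by apply/funext => y; rewrite fct_sumE.
exact: is_derive_sum.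
Qed.

Lemma is_derive_lsubmx (R : realType) (V : normedModType R) n1 n2
    (a : V -> 'rV[R]_(n1 + n2)) (da : 'rV[R]_(n1 + n2)) x v j :
  is_derive x v a da -> is_derive x v (fun y => lsubmx (a y) 0 j) (lsubmx da 0 j).
Proof.
move=> ad; under eq_fun do rewrite mxE; rewrite mxE.
exact: is_derive_entry.
Qed.

Lemma is_derive_rsubmx (R : realType) (V : normedModType R) n1 n2
    (a : V -> 'rV[R]_(n1 + n2)) (da : 'rV[R]_(n1 + n2)) x v j :
  is_derive x v a da -> is_derive x v (fun y => rsubmx (a y) 0 j) (rsubmx da 0 j).
Proof.
move=> ad; under eq_fun do rewrite mxE; rewrite mxE.
exact: is_derive_entry.
Qed.

Lemma is_derive_re_herm (R : realType) (V : normedModType R) n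
    (a b : V -> 'rV[R]_(n + n)) (da db : 'rV[R]_(n + n)) x v :
  is_derive x v a da -> is_derive x v b db ->
  is_derive x v (fun y => re_herm (a y) (b y))
    (re_herm da (b x) + re_herm (a x) db).
Proof.
move=> ad bd; apply: is_derive_eq.
  apply: is_derive_big => j; apply: is_derive_add; apply: is_derive_mul;
  by [exact: is_derive_lsubmx | exact: is_derive_rsubmx].
by rewrite /re_herm -big_split; apply: eq_bigr => j _ /=; ring.
Qed.

Lemma is_derive_im_herm (R : realType) (V : normedModType R) n
    (a b : V -> 'rV[R]_(n + n)) (da db : 'rV[R]_(n + n)) x v :
  is_derive x v a da -> is_derive x v b db ->
  is_derive x v (fun y => im_herm (a y) (b y))
    (im_herm da (b x) + im_herm (a x) db).
Proof.
move=> ad bd; apply: is_derive_eq.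
  apply: is_derive_big => j; apply: is_derive_add; last apply: is_derive_opp;
  apply: is_derive_mul; by [exact: is_derive_lsubmx | exact: is_derive_rsubmx].
by rewrite /im_herm -big_split; apply: eq_bigr => j _ /=; ring.
Qed.

Lemma is_derive_scale (R : realType) (V : normedModType R) n (k : V -> R)
    (a : V -> 'rV[R]_n) (dk : R) (da : 'rV[R]_n) x v :
  is_derive x v k dk -> is_derive x v a da ->
  is_derive x v (fun y => k y *: a y) (dk *: a x + k x *: da).
Proof.
move=> kd ad; apply: is_derive_mx => i j.
under eq_fun do rewrite mxE; rewrite !mxE.
by apply: is_derive_mul => //; exact: is_derive_entry.
Qed.

Lemma is_derive_mul_i (R : realType) (V : normedModType R) n
    (a : V -> 'rV[R]_(n + n)) (da : 'rV[R]_(n + n)) x v :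
  is_derive x v a da -> is_derive x v (fun y => mul_i (a y)) (mul_i da).
Proof.
move=> ad; apply: is_derive_mx => i j.
rewrite ord1; have [k ->|k ->] := split_ordP j.
  under eq_fun do rewrite row_mxEl mxE; rewrite row_mxEl mxE.
  by apply: is_derive_opp; exact: is_derive_rsubmx.
under eq_fun do rewrite row_mxEr; rewrite row_mxEr.
exact: is_derive_lsubmx.
Qed.

Lemma is_derive_defect (R : realType) (V : normedModType R) n
    (z : V -> 'rV[R]_(n + n)) (dz : 'rV[R]_(n + n)) x v :
  is_derive x v z dz ->
  is_derive x v (fun y => 1 - re_herm (z y) (z y)) (- 2 * re_herm dz (z x)).
Proof.
move=> zd; apply: is_derive_eq.
  apply: is_derive_add; apply: is_derive_opp.
  exact: is_derive_re_herm.
by rewrite (re_hermC (z x)); ring.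
Qed.

Lemma ball_defect_neq0 (R : realType) n (z : 'rV[R]_(n + n)) :
  complex_ball n z -> 1 - re_herm z z != 0.
Proof. by rewrite /complex_ball /= => z1; rewrite gt_eqF// subr_gt0. Qed.

(** Compatibility of [bergman_conn] with the metric, for vector fields a and b
along an arbitrary map z into the ball: the derivative of h(a, b) only involves
the covariant derivatives of a and b. *)
Lemma is_derive_ch_metric (R : realType) (V : normedModType R) n
    (z a b : V -> 'rV[R]_(n + n)) (dz da db : 'rV[R]_(n + n)) x v :
  complex_ball n (z x) ->
  is_derive x v z dz -> is_derive x v a da -> is_derive x v b db ->
  is_derive x v (fun y => complex_hyperbolic_metric n (z y) (a y) (b y))
    (complex_hyperbolic_metric n (z x) (da + bergman_conn (z x) dz (a x)) (b x)
     + complex_hyperbolic_metric n (z x) (a x) (db + bergman_conn (z x) dz (b x))).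
Proof.
move=> /ball_defect_neq0 s0 zd ad bd; have sd := is_derive_defect zd.
rewrite /complex_hyperbolic_metric; under eq_fun do rewrite [_ ^+ 2]expr2.
apply: is_derive_eq.
  apply: is_derive_mul.
    apply: is_derive_add.
      by apply: is_derive_mul sd _; exact: is_derive_re_herm.
    apply: is_derive_add; apply: is_derive_mul;
    by [exact: is_derive_re_herm | exact: is_derive_im_herm].
  by apply: (is_derive_inv _ (is_derive_mul sd sd)); rewrite mulf_neq0.
rewrite /bergman_conn !hermE.
set Z := z x in s0 *; set A := a x; set B := b x.
rewrite ?(re_hermC Z A) ?(re_hermC Z B) ?(re_hermC Z dz) ?(im_hermC Z A).
rewrite ?(im_hermC Z B) ?(im_hermC Z dz) ?(re_hermC A dz) ?(re_hermC B dz).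
rewrite ?(im_hermC A dz) ?(im_hermC B dz) ?(re_hermC B A) ?(im_hermC B A).
rewrite ?im_herm_diag.
field.
by rewrite s0.
Qed.

(** The derivative of [bergman_conn z a b] when z, a, b move with velocities
dz, da, db. *)
Definition bergman_conn_dot (R : realType) n (z dz a da b db : 'rV[R]_(n + n)) :
    'rV[R]_(n + n) :=
  bergman_conn z da b + bergman_conn z a db
  + (1 - re_herm z z)^-1 *:
    ((2 * re_herm dz z) *: bergman_conn z a b
     + (re_herm a dz *: b + im_herm a dz *: mul_i b
        + (re_herm b dz *: a + im_herm b dz *: mul_i a))).

Lemma is_derive_bergman_conn (R : realType) (V : normedModType R) n
    (z a b : V -> 'rV[R]_(n + n)) (dz da db : 'rV[R]_(n + n)) x v :
  complex_ball n (z x) ->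
  is_derive x v z dz -> is_derive x v a da -> is_derive x v b db ->
  is_derive x v (fun y => bergman_conn (z y) (a y) (b y))
    (bergman_conn_dot (z x) dz (a x) da (b x) db).
Proof.
move=> /ball_defect_neq0 s0 zd ad bd; have sd := is_derive_defect zd.
apply: is_derive_eq.
  apply: is_derive_scale; first exact: is_derive_inv sd.
  apply: is_derive_add; apply: is_derive_add; apply: is_derive_scale;
  by [exact: is_derive_re_herm | exact: is_derive_im_herm | exact: is_derive_mul_i |].
rewrite /bergman_conn_dot /bergman_conn; apply/rowP => j; rewrite !mxE.
field.
by rewrite s0.
Qed.

(** The imaginary part of the Hermitian metric whose real part is
[complex_hyperbolic_metric n]. *)
Definition im_metric (R : realType) n (z u v : 'rV[R]_(n + n)) : R :=
  ((1 - re_herm z z) * im_herm u v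
   + (im_herm u z * re_herm v z - re_herm u z * im_herm v z))
  / (1 - re_herm z z) ^+ 2.

Lemma ch_metric_mul_il (R : realType) n (z u v : 'rV[R]_(n + n)) :
  complex_hyperbolic_metric n z (mul_i u) v = - im_metric z u v.
Proof. by rewrite /complex_hyperbolic_metric /im_metric !hermE; ring. Qed.

(** * Curvature of the ball *)

(** For a vector field w along a two-parameter map z, the left side is the
commutator of the covariant derivatives in the two parameters, expanded through
[bergman_conn_dot]: x and y are the velocities of z, xy its mixed second
derivative, and wx, wy, wxy the derivatives of w.  Everything that is not
tensorial cancels because mixed derivatives agree, and what remains is the
curvature tensor of constant holomorphic curvature -4, in complex notation
H(w,x) y - H(w,y) x - (H(x,y) - H(y,x)) w. *)
Lemma bergman_curvature (R : realType) n (z x y xy w wx wy wxy : 'rV[R]_(n + n)) :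
  complex_ball n z ->
  (wxy + bergman_conn_dot z x y xy w wx + bergman_conn z x (wy + bergman_conn z y w))
  - (wxy + bergman_conn_dot z y x xy w wy + bergman_conn z y (wx + bergman_conn z x w))
  = complex_hyperbolic_metric n z w x *: y + im_metric z w x *: mul_i y
    - (complex_hyperbolic_metric n z w y *: x + im_metric z w y *: mul_i x)
    - (2 * im_metric z x y) *: mul_i w.
Proof.
move=> /ball_defect_neq0 s0.
have chmE u v : complex_hyperbolic_metric n z u v = (1 - re_herm z z)^-1 * re_herm u v
    + (1 - re_herm z z)^-1 ^+ 2 * (re_herm u z * re_herm v z + im_herm u z * im_herm v z).
  by rewrite /complex_hyperbolic_metric; field.
have imE u v : im_metric z u v = (1 - re_herm z z)^-1 * im_herm u v
    + (1 - re_herm z z)^-1 ^+ 2 * (im_herm u z * re_herm v z - re_herm u z * im_herm v z).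
  by rewrite /im_metric; field.
rewrite !(chmE, imE) /bergman_conn_dot /bergman_conn.
(* As (1 - |z|^2)^-1 is now the only denominator, the identity is polynomial in it. *)
move: (1 - re_herm z z)^-1 => k.
rewrite !(mul_iD, mul_iZ, mul_iK, hermE).
rewrite ?(re_hermC z x) ?(re_hermC z y) ?(re_hermC z w) ?(im_hermC z x).
rewrite ?(im_hermC z y) ?(im_hermC z w) ?(re_hermC w x) ?(re_hermC w y).
rewrite ?(im_hermC w x) ?(im_hermC w y) ?(re_hermC y x) ?(im_hermC y x).
apply/rowP => j; rewrite !mxE.
ring.
Qed.

(** The curvature tensor of [bergman_curvature] with w = x, paired with y.  The
sign is such that this is minus the sectional curvature times the squared area
of the parallelogram; being at least that squared area, it shows that sectional
curvatures are at most -1. *)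
Lemma bergman_sectional_curvature (R : realType) n (z x y : 'rV[R]_(n + n)) :
  complex_hyperbolic_metric n z
    (complex_hyperbolic_metric n z x x *: y + im_metric z x x *: mul_i y
     - (complex_hyperbolic_metric n z x y *: x + im_metric z x y *: mul_i x)
     - (2 * im_metric z x y) *: mul_i x) y
  = complex_hyperbolic_metric n z x x * complex_hyperbolic_metric n z y y
    - complex_hyperbolic_metric n z x y ^+ 2 + 3 * im_metric z x y ^+ 2.
Proof.
have -> : im_metric z x x = 0 by rewrite /im_metric im_herm_diag; ring.
rewrite scale0r addr0 !(ch_metricDl, ch_metricNl, ch_metricZl) !ch_metric_mul_il.
ring.
Qed.

(** * Symmetry of second derivatives *)

Lemma is_derive_line (R : realType) (V W : normedModType R) (g : V -> W) x u (s : R) :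
  derivable g (s *: u + x) u ->
  is_derive s 1 (fun t => g (t *: u + x)) ('D_u g (s *: u + x)).
Proof.
have E : (fun h : R => h^-1 *: (((fun t => g (t *: u + x)) \o shift s) (h *: 1)
      - g (s *: u + x))) =
    (fun h => h^-1 *: ((g \o shift (s *: u + x)) (h *: u) - g (s *: u + x))).
  by apply/funext => h /=; rewrite [h *: 1]mulr1 scalerDl addrA.
by move=> gd; apply: DeriveDef; rewrite /derivable /derive E.
Qed.

Lemma is_derive_shift_arg (R : realType) (V W : normedModType R) (g : V -> W) x u w :
  derivable g (w + x) u ->
  is_derive x u (fun y => g (w + y)) ('D_u g (w + x)).
Proof.
have E : (fun h : R => h^-1 *: (((fun y => g (w + y)) \o shift x) (h *: u)
      - g (w + x))) =
    (fun h => h^-1 *: ((g \o shift (w + x)) (h *: u) - g (w + x))).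
  by apply/funext => h /=; rewrite (addrCA w).
by move=> gd; apply: DeriveDef; rewrite /derivable /derive E.
Qed.

Lemma MVT_line (R : realType) (V : normedModType R) (g : V -> R) x u (t : R) :
  0 < t -> (forall s, 0 <= s <= t -> derivable g (s *: u + x) u) ->
  exists2 s, 0 <= s <= t & g (t *: u + x) - g x = t * 'D_u g (s *: u + x).
Proof.
move=> t0 gd; pose phi s := g (s *: u + x).
have [|/=|s] := @MVT R phi (fun s => 'D_u g (s *: u + x)) 0 t t0.
- move=> s; rewrite in_itv /= => /andP[s0 st].
  by apply: is_derive_line; apply: gd; rewrite !ltW.
- apply: derivable_within_continuous => s; rewrite in_itv /= => /gd sd.
  by have [] := is_derive_line sd.
- rewrite in_itv /= => /andP[s0 st] E; exists s; first by rewrite !ltW.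
  by move: E; rewrite /phi scale0r add0r subr0 mulrC.
Qed.

(** The second difference over the parallelogram spanned by t u and t v is
symmetric in u and v; two applications of the mean value theorem turn it into
t^2 times an iterated derivative at some point of the parallelogram. *)
Lemma second_difference (R : realType) (V : normedModType R) (g : V -> R) x u v (t : R) :
  0 < t ->
  (forall a b, 0 <= a <= t -> 0 <= b <= t ->
    derivable g (b *: v + (a *: u + x)) u /\
    derivable ('D_u g) (b *: v + (a *: u + x)) v) ->
  exists a b, [/\ 0 <= a <= t, 0 <= b <= t &
    g (t *: v + (t *: u + x)) - g (t *: u + x) - (g (t *: v + x) - g x) =
    t * (t * 'D_v ('D_u g) (b *: v + (a *: u + x)))].
Proof.
move=> t0 gd; have tt : 0 <= t <= t by rewrite lexx ltW.
have zt : 0 <= (0 : R) <= t by rewrite lexx ltW.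
pose G y := g (t *: v + y) - g y.
have Gd a : 0 <= a <= t -> is_derive (a *: u + x) u G
    ('D_u g (t *: v + (a *: u + x)) - 'D_u g (a *: u + x)).
  move=> at_; have [d1 _] := gd _ _ at_ tt; have [d2 _] := gd _ _ at_ zt.
  rewrite scale0r add0r in d2.
  apply: is_derive_add; first exact: is_derive_shift_arg.
  by apply: is_derive_opp; exact: derivableP.
have [a at_ Ga] : exists2 a, 0 <= a <= t &
    G (t *: u + x) - G x = t * 'D_u G (a *: u + x).
  by apply: MVT_line => // s /Gd[].
have [b bt Gb] : exists2 b, 0 <= b <= t &
    'D_u g (t *: v + (a *: u + x)) - 'D_u g (a *: u + x) =
    t * 'D_v ('D_u g) (b *: v + (a *: u + x)).
  by apply: MVT_line => // s st; have [] := gd _ _ at_ st.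
exists a, b; split => //; rewrite -Gb -/(G _) -/(G _) Ga.
by have [_ ->] := Gd _ at_.
Qed.

(** Schwarz's theorem: by [second_difference] both iterated derivatives take a
common value at points arbitrarily close to x, so by continuity they agree at
x. *)
Lemma derive_comm (R : realType) (V : normedModType R) (U : set V) (g : V -> R) x u v :
  open U -> U x ->
  (forall y, U y -> [/\ derivable g y u, derivable g y v,
     derivable ('D_u g) y v & derivable ('D_v g) y u]) ->
  {for x, continuous ('D_v ('D_u g))} -> {for x, continuous ('D_u ('D_v g))} ->
  'D_v ('D_u g) x = 'D_u ('D_v g) x.
Proof.
move=> oU Ux gd cvu cuv; apply/eqP/negPn/negP => neq.
pose A : R := 'D_v ('D_u g) x; pose B : R := 'D_u ('D_v g) x.
pose eps : R := `|A - B| / 2.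
have eps0 : 0 < eps by rewrite divr_gt0// normr_gt0 subr_eq0.
have cA : \forall y \near x, `|A - 'D_v ('D_u g) y| < eps.
  exact: (cvgrPdist_lt _ _).1 cvu _ eps0.
have cB : \forall y \near x, `|B - 'D_u ('D_v g) y| < eps.
  exact: (cvgrPdist_lt _ _).1 cuv _ eps0.
have [e /= e0 eU] := (nbhs_ballP _ _).1
  (@filterI _ _ _ _ _ (open_nbhs_nbhs (conj oU Ux)) (@filterI _ _ _ _ _ cA cB)).
(* For this t the whole parallelogram lies in the ball of radius e around x. *)
pose k : R := `|u| + `|v| + 1.
have k0 : 0 < k by rewrite ltr_wpDl// addr_ge0.
pose t := e / 2 / k.
have t0 : 0 < t by rewrite !divr_gt0.
have small a b : 0 <= a <= t -> 0 <= b <= t -> ball x e (b *: v + (a *: u + x)).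
  move=> /andP[a0 at_] /andP[b0 bt]; rewrite -ball_normE /=.
  rewrite addrA opprD addrCA subrr addr0 normrN.
  apply: (le_lt_trans (ler_normD _ _)); rewrite !normrZ !ger0_norm//.
  apply: (@le_lt_trans _ _ (t * `|v| + t * `|u|)).
    by rewrite lerD// ler_wpM2r.
  rewrite -mulrDr; apply: (@le_lt_trans _ _ (t * k)).
    by apply: ler_wpM2l; [exact: ltW|rewrite /k (addrC `|v|) lerDl].
  by rewrite /t divfK ?gt_eqF// ltr_pdivrMr// ltr_pMr// ltr1n.
have [|a [b [at_ bt E1]]] := @second_difference R V g x u v t t0.
  by move=> a b at_ bt; have [/gd[? _ ? _] _] := eU _ (small _ _ at_ bt).
have [|c [d [ct dt E2]]] := @second_difference R V g x v u t t0.
  move=> a' b' at' bt'; rewrite [b' *: u + _]addrCA.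
  by have [/gd[_ ? _ ?] _] := eU _ (small _ _ bt' at').
have E : 'D_v ('D_u g) (b *: v + (a *: u + x)) = 'D_u ('D_v g) (d *: u + (c *: v + x)).
  have tn0 : t != 0 by rewrite gt_eqF.
  apply: (mulfI tn0); apply: (mulfI tn0).
  apply: (etrans (esym E1)); apply: (etrans _ E2).
  rewrite [t *: v + (t *: u + x)]addrCA.
  move: (g (t *: u + (t *: v + x))) (g (t *: u + x)) (g (t *: v + x)) (g x) => *.
  ring.
have [_ [h1 _]] := eU _ (small _ _ at_ bt).
have [_ [_ h2]] := eU _ (small _ _ dt ct).
move: h2; rewrite addrCA -E distrC => h2.
have := le_lt_trans (ler_normD _ _) (ltrD h1 h2).
by rewrite subrKA /eps -splitr ltxx.
Qed.

Lemma Ck_derive_comm (R : realType) m N (U : set 'rV[R]_m) (f : 'rV[R]_m -> 'rV[R]_N)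
    x u v :
  open U -> Ck 2 U f -> U x -> 'D_v ('D_u f) x = 'D_u ('D_v f) x.
Proof.
move=> oU [fd f2] Ux.
have D1 w y : U y -> derivable f y w by move=> /fd /diff_derivable.
have D2 w w' y : U y -> derivable ('D_w f) y w'.
  by move=> Uy; apply: diff_derivable; apply: (f2 w).1.
have C w w' : {for x, continuous ('D_w' ('D_w f))}.
  by have [_ f3] := f2 w; exact: f3.
have nbhsU y : U y -> nbhs y U by move=> Uy; exact: open_nbhs_nbhs.
apply/rowP => j; pose g y := f y 0 j.
have g1 w y : U y -> 'D_w f y 0 j = 'D_w g y by move=> /D1 fy; rewrite derive_mx// mxE.
have g2 w w' y : U y -> 'D_w' ('D_w f) y 0 j = 'D_w' ('D_w g) y.
  move=> Uy; rewrite derive_mx; last exact: D2.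
  rewrite mxE; apply: near_eq_derive.
  exact: (filterS (g1 w) (nbhsU _ _)).
have gd w y : U y -> derivable g y w.
  by move=> /D1 /derivable_mxP; exact.
have gd2 w w' y : U y -> derivable ('D_w g) y w'.
  move=> Uy; apply: (@near_eq_derivable _ _ _ (fun y => 'D_w f y 0 j)).
    exact: (filterS (g1 w) (nbhsU _ _)).
  by have /derivable_mxP := D2 w w' _ Uy; exact.
have gc w w' : {for x, continuous ('D_w' ('D_w g))}.
  have c : {for x, continuous (fun y => 'D_w' ('D_w f) y 0 j)}.
    apply: (@continuous_comp _ _ _ ('D_w' ('D_w f)) (fun M : 'rV[R]_N => M 0 j)).
      exact: C.
    exact: coord_continuous.
  rewrite /prop_for /continuous_at -(g2 _ _ _ Ux).
  apply: cvg_trans c; apply: near_eq_cvg.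
    exact: nbhs_filter.
  exact: (filterS (g2 w w') (nbhsU _ Ux)).
apply: (etrans (g2 u v x Ux)); apply: (etrans _ (esym (g2 v u x Ux))).
apply: (@derive_comm _ _ U g x u v oU Ux); [|exact: gc|exact: gc] => y Uy.
by split; [exact: gd|exact: gd|exact: gd2|exact: gd2].
Qed.

(** * Christoffel symbols and minimality in the ball *)

Lemma ch_metric_mx_unit (R : realType) n (z : 'rV[R]_(n + n)) :
  complex_ball n z -> metric_mx (complex_hyperbolic_metric n) z \in unitmx.
Proof.
move=> zB; rewrite -row_free_unit -kermx_eq0; apply/rowV0P => v /sub_kermxP vM.
apply: (ch_metric_eq0 zB).
have chm_lin : linear (complex_hyperbolic_metric n z v).
  by move=> k a b; rewrite ch_metricDr ch_metricZr.
rewrite (linear_row_sum chm_lin v); apply: big1 => l _.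
have -> : complex_hyperbolic_metric n z v (delta_mx 0 l) = 0; last exact: scaler0.
have chm_linl : linear (complex_hyperbolic_metric n z ^~ (delta_mx 0 l)).
  by move=> k a b; rewrite ch_metricDl ch_metricZl.
rewrite (linear_row_sum chm_linl v).
transitivity ((v *m metric_mx (complex_hyperbolic_metric n) z) 0 l).
  by rewrite mxE; apply: eq_bigr => b _; rewrite mxE.
by rewrite vM mxE.
Qed.

Lemma partial_ch_metric (R : realType) n (z : 'rV[R]_(n + n)) (i j l : 'I_(n + n)) :
  complex_ball n z ->
  partial i (fun y => metric_mx (complex_hyperbolic_metric n) y j l) z =
  complex_hyperbolic_metric n z (bergman_conn z (delta_mx 0 i) (delta_mx 0 j)) (delta_mx 0 l)
  + complex_hyperbolic_metric n z (delta_mx 0 j) (bergman_conn z (delta_mx 0 i) (delta_mx 0 l)).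
Proof.
move=> zB; rewrite /partial; under eq_fun do rewrite mxE.
have c a : is_derive z (delta_mx 0 i) (fun=> a : 'rV[R]_(n + n)) 0.
  exact: is_derive_cst.
have [_ ->] := is_derive_ch_metric zB (is_derive_id _ _) (c (delta_mx 0 j)) (c (delta_mx 0 l)).
by rewrite !add0r.
Qed.

(** Koszul's formula: [bergman_conn] is symmetric and compatible with the metric,
so the Christoffel symbols of the first kind are h(B(e_i, e_j), e_l), B being
[bergman_conn] at z.  Raising the index then recovers the coordinates of
B(e_i, e_j). *)
Lemma christoffel_ch_metric (R : realType) n (z : 'rV[R]_(n + n)) (k i j : 'I_(n + n)) :
  complex_ball n z ->
  christoffel (complex_hyperbolic_metric n) z k i j =
  bergman_conn z (delta_mx 0 i) (delta_mx 0 j) 0 k.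
Proof.
move=> zB; rewrite /christoffel.
set w := bergman_conn z (delta_mx 0 i) (delta_mx 0 j).
set M := metric_mx _ z.
have Mw l : complex_hyperbolic_metric n z w (delta_mx 0 l) = (M *m w^T) l 0.
  have chm_linl : linear (complex_hyperbolic_metric n z ^~ (delta_mx 0 l)).
    by move=> c a b; rewrite ch_metricDl ch_metricZl.
  rewrite (linear_row_sum chm_linl w) mxE; apply: eq_bigr => b _.
  by rewrite [M l b]mxE [w^T b 0]mxE [RHS]mulrC (ch_metricC z (delta_mx 0 l)).
transitivity (\sum_l invmx M k l * (M *m w^T) l 0).
  rewrite mulr_sumr; apply: eq_bigr => l _; rewrite -Mw !partial_ch_metric//.
  rewrite (bergman_connC z (delta_mx 0 l) (delta_mx 0 i)).
  rewrite (bergman_connC z (delta_mx 0 l) (delta_mx 0 j)).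
  rewrite (bergman_connC z (delta_mx 0 j) (delta_mx 0 i)) -/w.
  rewrite [complex_hyperbolic_metric n z (delta_mx 0 i) _]ch_metricC.
  rewrite [complex_hyperbolic_metric n z (delta_mx 0 j) _]ch_metricC.
  by field.
transitivity ((invmx M *m (M *m w^T)) k 0); first by rewrite [RHS]mxE.
by rewrite mulKmx ?ch_metric_mx_unit// mxE.
Qed.

Lemma cov_partial_ch_metric (R : realType) m n (f : 'rV[R]_m -> 'rV[R]_(n + n)) i j p :
  complex_ball n (f p) ->
  cov_partial (complex_hyperbolic_metric n) f i j p =
  partial i (partial j f) p + bergman_conn (f p) (partial i f p) (partial j f p).
Proof.
move=> fB; rewrite /cov_partial; congr (_ + _); apply/rowP => a; rewrite mxE.
rewrite -bergman_conn_sum; apply: eq_bigr => b _; apply: eq_bigr => c _.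
by rewrite christoffel_ch_metric.
Qed.

(** Pairing the mean curvature with a normal vector w does not see the tangential
correction in the second fundamental form. *)
Lemma minimal_trace (R : realType) m n (f : 'rV[R]_m.+1 -> 'rV[R]_(n + n)) p
    (w : 'rV[R]_(n + n)) :
  mean_curvature (complex_hyperbolic_metric n) f p = 0 ->
  (forall k, complex_hyperbolic_metric n (f p) w (partial k f p) = 0) ->
  \sum_i \sum_j invmx (first_form (complex_hyperbolic_metric n) f p) i j
    * complex_hyperbolic_metric n (f p) w
        (cov_partial (complex_hyperbolic_metric n) f i j p) = 0.
Proof.
move=> /eqP; rewrite scaler_eq0 invr_eq0 pnatr_eq0 /= => /eqP H0 wX.
have normal v : complex_hyperbolic_metric n (f p) w
    (normal_part (complex_hyperbolic_metric n) f p v) =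
    complex_hyperbolic_metric n (f p) w v.
  rewrite /normal_part ch_metricDr -scaleN1r ch_metricZr ch_metric_sumr big1 ?mulr0 ?addr0// => k _.
  by rewrite ch_metric_sumr big1// => l _; rewrite ch_metricZr wX mulr0.
transitivity (complex_hyperbolic_metric n (f p) w 0); last first.
  by rewrite -(scale0r 0) ch_metricZr mul0r.
rewrite -H0 ch_metric_sumr; apply: eq_bigr => i _; rewrite ch_metric_sumr.
by apply: eq_bigr => j _; rewrite ch_metricZr normal.
Qed.

(** * Cones in the ball *)

Lemma is_derive_along_const (R : realType) (V W : normedModType R) (g : V -> W) x v :
  (forall t : R, g (t *: v + x) = g x) -> is_derive x v g 0.
Proof.
move=> gE; have E : (fun h : R => h^-1 *: ((g \o shift x) (h *: v) - g x)) = fun=> 0.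
  by apply/funext => h /=; rewrite gE subrr scaler0.
by apply: DeriveDef; rewrite /derivable /derive E; [exact: is_cvg_cst|exact: lim_cst].
Qed.

Lemma cone_domain_open (R : realType) m : open (@cone_domain R m).
Proof.
have c : continuous (fun p : 'rV[R]_(1 + m) => p 0 (lshift m 0)).
  by move=> p; exact: coord_continuous.
rewrite (_ : cone_domain m = (fun p : 'rV[R]_(1 + m) => p 0 (lshift m 0)) @^-1` [set t | 0 < t]).
  by apply: open_comp => [p _|]; [exact: c|exact: open_gt].
by apply/seteqP; split => p; rewrite /cone_domain /= mxE.
Qed.

Lemma smooth_derive (R : realType) (m : nat) (V : normedModType R) (U : set 'rV[R]_m)
    (f : 'rV[R]_m -> V) v :
  smooth U f -> smooth U ('D_v f).
Proof. by move=> fs j; exact: (fs j.+1).2. Qed.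

Lemma smooth_is_derive (R : realType) (m : nat) (V : normedModType R)
    (U : set 'rV[R]_m) (f : 'rV[R]_m -> V) v p :
  smooth U f -> U p -> is_derive p v f ('D_v f p).
Proof.
by move=> fs Up; apply/derivableP/diff_derivable; exact: (fs 1%N).1.
Qed.

(** The pullback of the Levi-Civita connection has no torsion. *)
Lemma cov_deriv_comm (R : realType) n m (U : set 'rV[R]_m) (f : 'rV[R]_m -> 'rV[R]_(n + n)) p u v :
  open U -> smooth U f -> U p ->
  'D_u ('D_v f) p + bergman_conn (f p) ('D_u f p) ('D_v f p) =
  'D_v ('D_u f) p + bergman_conn (f p) ('D_v f p) ('D_u f p).
Proof.
move=> oU fs Up.
by rewrite (Ck_derive_comm v u oU (fs 2%N) Up) bergman_connC.
Qed.

Lemma cone_metric_radial (R : realType) m (G : metric R m) (p u : 'rV[R]_(1 + m)) :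
  (forall q v, G q 0 v = 0) ->
  cone_metric G p (delta_mx 0 (lshift m 0)) u = u 0 (lshift m 0).
Proof.
move=> G0; have -> : delta_mx 0 (lshift m 0) = row_mx (1 : 'rV[R]_1) (0 : 'rV[R]_m).
  apply/rowP => j; have [k ->|k ->] := split_ordP j.
    by rewrite row_mxEl !mxE !ord1 !eqxx.
  by rewrite row_mxEr !mxE eq_rlshift andbF.
by rewrite /cone_metric row_mxKl row_mxKr G0 mulr0 addr0 !mxE mul1r.
Qed.

Lemma cone_metric_transverse (R : realType) m (G : metric R m) (p : 'rV[R]_(1 + m)) (k l : 'I_m) :
  cone_metric G p (delta_mx 0 (rshift 1 k)) (delta_mx 0 (rshift 1 l)) =
  p 0 (lshift m 0) ^+ 2 * G (rsubmx p) (delta_mx 0 k) (delta_mx 0 l).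
Proof.
have E (j : 'I_m) : delta_mx 0 (rshift 1 j) = row_mx (0 : 'rV[R]_1) (delta_mx 0 j : 'rV[R]_m).
  apply/rowP => i; have [a ->|a ->] := split_ordP i.
    by rewrite row_mxEl !mxE eq_lrshift andbF.
  by rewrite row_mxEr !mxE eq_rshift.
by rewrite /cone_metric !E !row_mxKl !row_mxKr !mxE mul0r add0r.
Qed.

Lemma is_derive_radius (R : realType) m (p : 'rV[R]_(1 + m)) :
  is_derive p (delta_mx 0 (lshift m 0)) (fun y : 'rV[R]_(1 + m) => y 0 (lshift m 0)) 1.
Proof.
by apply: (is_derive_eq (is_derive_entry _ _ (is_derive_id _ _))); rewrite mxE !eqxx.
Qed.

Lemma is_derive_fiber (R : realType) m (W : normedModType R) (g : 'rV[R]_m -> W)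
    (p : 'rV[R]_(1 + m)) :
  is_derive p (delta_mx 0 (lshift m 0)) (fun y => g (rsubmx y)) 0.
Proof.
apply: is_derive_along_const => t; congr (g _).
by apply/rowP => j; rewrite !mxE eq_rlshift andbF mulr0 add0r.
Qed.

Lemma is_derive_cone_transverse (R : realType) m (G : metric R m)
    (p : 'rV[R]_(1 + m)) (k : 'I_m) :
  is_derive p (delta_mx 0 (lshift m 0))
    (fun y => cone_metric G y (delta_mx 0 (rshift 1 k)) (delta_mx 0 (rshift 1 k)))
    (2 * p 0 (lshift m 0) * G (rsubmx p) (delta_mx 0 k) (delta_mx 0 k)).
Proof.
under eq_fun do rewrite cone_metric_transverse expr2.
have rd := is_derive_radius p.
have Gd := is_derive_fiber (fun q => G q (delta_mx 0 k) (delta_mx 0 k)) p.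
by apply: (is_derive_eq (is_derive_mul (is_derive_mul rd rd) Gd)); ring.
Qed.

(** The Gauss equation at one point, as algebra: x and y stand for X_0 and X_k, so
that cxx, cyx, cyy are D_0 X_0, D_k X_0, D_k X_k.  The last two hypotheses are
the derivatives of h(D_0 X_0, X_k) = 0 along X_k and of h(D_k X_0, X_k) = r g
along X_0.  Subtracting them leaves the curvature term, which is at least
h(y, y), together with g and the squared norm of D_k X_0; the latter is at least
g because the component of D_k X_0 along X_k already contributes g. *)
Lemma radial_curvature_bound (R : realType) n (z x y xx yx xy yxx xyx cyy : 'rV[R]_(n + n))
    (r g : R) :
  let h := complex_hyperbolic_metric n z in
  let cxx := xx + bergman_conn z x x in
  let cyx := yx + bergman_conn z y x in
  let cxy := xy + bergman_conn z x y in
  complex_ball n z -> 0 < r -> xy = yx -> yxx = xyx ->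
  h x x = 1 -> h x y = 0 -> h y y = r ^+ 2 * g -> h cyx y = r * g ->
  h (yxx + bergman_conn_dot z y x yx x yx + bergman_conn z y cxx) y + h cxx cyy = 0 ->
  h (xyx + bergman_conn_dot z x y xy x xx + bergman_conn z x cyx) y + h cyx cxy = g ->
  r ^+ 2 * g <= h cxx cyy.
Proof.
move=> h cxx cyx cxy zB r0 xyE yxxE hxx hxy hyy hcyx; rewrite yxxE => E0 E1.
(* Cauchy-Schwarz, as nonnegativity of the squared norm of w - y / r. *)
have gN w : h w y = r * g -> g <= h w w.
  move=> hwy; have := ch_metric_ge0 (w - r^-1 *: y) zB.
  rewrite !(ch_metricDl, ch_metricNl, ch_metricDr, ch_metricNr, ch_metricZl, ch_metricZr) (ch_metricC z y w) -/h hyy hwy.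
  have r_neq0 : r != 0 by rewrite gt_eqF.
  rewrite expr2 -!mulrA !mulKf//; lra.
have cxyE : cxy = cyx by rewrite /cxy xyE bergman_connC.
rewrite xyE cxyE in E1.
have := bergman_sectional_curvature z x y.
rewrite -(bergman_curvature x y yx x xx yx xyx zB) ch_metricDl ch_metricNl.
rewrite -/h hxx hxy hyy -/cxx -/cyx => curv.
by have := gN _ hcyx; have := sqr_ge0 (im_metric z x y); lra.
Qed.

(** For an isometric immersion of a cone, the radial acceleration is normal
because radial lines are geodesics of the cone, and pairing it with the second
fundamental form is bounded below because the cone is flat in radial planes while
the ball is curved by at most -1. *)
Lemma cone_radial_gauss (R : realType) n m (G : metric R m) (f : 'rV[R]_(1 + m) -> 'rV[R]_(n + n)) :
  (forall q v, G q 0 v = 0) ->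
  (forall p, cone_domain m p -> complex_ball n (f p)) ->
  isometric_immersion (complex_hyperbolic_metric n) f (cone_domain m) (cone_metric G) ->
  let cov i j p := cov_partial (complex_hyperbolic_metric n) f i j p in
  forall p, cone_domain m p ->
   (forall k, complex_hyperbolic_metric n (f p) (cov (lshift m 0) (lshift m 0) p) (partial k f p) = 0) /\
   (forall k : 'I_m, cone_metric G p (delta_mx 0 (rshift 1 k)) (delta_mx 0 (rshift 1 k))
     <= complex_hyperbolic_metric n (f p) (cov (lshift m 0) (lshift m 0) p) (cov (rshift 1 k) (rshift 1 k) p)).
Proof.
have aux1 (a b : R) : 0 = a + b -> 0 = b + b -> a = 0 by move=> *; lra.
have aux2 (a g r : R) : 2 * r * g = a + a -> a = r * g.
  by move=> *; lra.
move=> G0 fB [[fs _] fiso] cov.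
pose U := @cone_domain R m; pose h p := complex_hyperbolic_metric n (f p).
have oU : open U by exact: cone_domain_open.
pose e i : 'rV[R]_(1 + m) := delta_mx 0 i.
(* [c i j] is the covariant derivative D_i X_j. *)
pose c i j p := 'D_(e i) ('D_(e j) f) p + bergman_conn (f p) ('D_(e i) f p) ('D_(e j) f p).
have covE i j p : U p -> cov i j p = c i j p by move=> /fB; exact: cov_partial_ch_metric.
have cC i j p : U p -> c i j p = c j i p by exact: cov_deriv_comm.
pose X i p := 'D_(e i) f p.
have fd i p : U p -> is_derive p (e i) f (X i p) by exact: smooth_is_derive.
have Xs j : smooth U (X j) by exact: smooth_derive.
have Xd i j p : U p -> is_derive p (e i) (X j) ('D_(e i) (X j) p).
  by move=> Up; exact: (smooth_is_derive _ (Xs j) Up).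
have Xdd i j k p : U p -> is_derive p (e i) ('D_(e j) (X k)) ('D_(e i) ('D_(e j) (X k)) p).
  by move=> Up; exact: (smooth_is_derive _ (smooth_derive _ (Xs k)) Up).
have nearU p : U p -> \forall y \near p, U y by move=> Up; exact: open_nbhs_nbhs.
have dG i j k p : U p -> is_derive p (e k) (fun y => cone_metric G y (e i) (e j))
    (h p (c k i p) (X j p) + h p (X i p) (c k j p)).
  move=> Up; apply: (@near_eq_is_derive _ _ _ (fun y => h y (X i y) (X j y))).
    by apply: filterS (nearU _ Up) => y Uy; exact: fiso.
  exact: (is_derive_ch_metric (fB _ Up) (fd k _ Up) (Xd k i _ Up) (Xd k j _ Up)).
pose o := lshift m (0 : 'I_1).
have cst0 (a : R) p k : is_derive p (e k) (fun=> a) 0 by exact: is_derive_cst.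
have hC p u v : h p u v = h p v u by exact: ch_metricC.
(* Radial lines are geodesics: subtract half of the derivative along X_k of the
   constant G_00 from the radial derivative of the constant G_0k. *)
have oo_X p k : U p -> h p (c o o p) (X k p) = 0.
  move=> Up.
  have [_ E1] := dG o k o _ Up; have [_ E2] := dG o o k _ Up.
  have F a b : 'D_(e b) (fun y => cone_metric G y (e o) (e a)) p = 0.
    under eq_fun do rewrite cone_metric_radial//.
    by have [] := cst0 (e a 0 (lshift m 0)) p b.
  rewrite F in E1; rewrite F in E2.
  rewrite (hC p (X o p)) (cC k o _ Up) in E2; rewrite (hC p (X o p)) in E1.
  exact: aux1 E1 E2.
have ko_X p (k : 'I_m) : U p -> h p (c (rshift 1 k) o p) (X (rshift 1 k) p) =
    p 0 o * G (rsubmx p) (delta_mx 0 k) (delta_mx 0 k).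
  move=> Up.
  have [_ E1] := dG (rshift 1 k) (rshift 1 k) o _ Up.
  have [_ E2] := is_derive_cone_transverse G p k.
  rewrite E2 (hC p (X _ p)) (cC o _ _ Up) in E1.
  exact: aux2 E1.
have cd i j k p : U p -> is_derive p (e i) (c j k)
   ('D_(e i) ('D_(e j) (X k)) p
    + bergman_conn_dot (f p) (X i p) (X j p) ('D_(e i) (X j) p) (X k p) ('D_(e i) (X k) p)).
  move=> Up; apply: (is_derive_add (Xdd i j k _ Up)).
  exact: (is_derive_bergman_conn (fB _ Up) (fd i _ Up) (Xd i j _ Up) (Xd i k _ Up)).
move=> p Up; split=> k; first by rewrite covE//; exact: oo_X.
rewrite !covE// -/o; set k' := rshift 1 k.
(* Differentiate the identity [oo_X] along X_k and [ko_X] along the radial field. *)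
have d0 : h p ('D_(e k') ('D_(e o) (X o)) p
    + bergman_conn_dot (f p) (X k' p) (X o p) ('D_(e k') (X o) p) (X o p) ('D_(e k') (X o) p)
    + bergman_conn (f p) (X k' p) (c o o p)) (X k' p) + h p (c o o p) (c k' k' p) = 0.
  have [_ <-] := is_derive_ch_metric (fB _ Up) (fd k' _ Up) (cd k' o o _ Up) (Xd k' k' _ Up).
  have [_ <-] := cst0 0 p k'; apply: near_eq_derive.
  by apply: filterS (nearU _ Up) => y; exact: oo_X.
have d1 : h p ('D_(e o) ('D_(e k') (X o)) p
    + bergman_conn_dot (f p) (X o p) (X k' p) ('D_(e o) (X k') p) (X o p) ('D_(e o) (X o) p)
    + bergman_conn (f p) (X o p) (c k' o p)) (X k' p) + h p (c k' o p) (c o k' p)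
    = G (rsubmx p) (delta_mx 0 k) (delta_mx 0 k).
  have [_ <-] := is_derive_ch_metric (fB _ Up) (fd o _ Up) (cd o k' o _ Up) (Xd o k' _ Up).
  transitivity ('D_(e o) (fun y : 'rV[R]_(1 + m) =>
      y 0 o * G (rsubmx y) (delta_mx 0 k) (delta_mx 0 k)) p).
    apply: near_eq_derive.
    by apply: filterS (nearU _ Up) => y; exact: ko_X.
  have rd := is_derive_radius p.
  have Gd := is_derive_fiber (fun q => G q (delta_mx 0 k) (delta_mx 0 k)) p.
  by have [_ ->] := is_derive_mul rd Gd; ring.
have S1 : 'D_(e k') ('D_(e o) (X o)) p = 'D_(e o) ('D_(e k') (X o)) p.
  exact: (Ck_derive_comm _ _ oU (Xs o 2%N) Up).
have S2 : 'D_(e o) (X k') p = 'D_(e k') (X o) p.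
  exact: (Ck_derive_comm _ _ oU (fs 2%N) Up).
have hoo : h p (X o p) (X o p) = 1.
  apply: (etrans (fiso p Up _ _)).
  by apply: (etrans (cone_metric_radial _ _ G0)); rewrite mxE !eqxx.
have hok : h p (X o p) (X k' p) = 0.
  apply: (etrans (fiso p Up _ _)).
  by apply: (etrans (cone_metric_radial _ _ G0)); rewrite mxE eq_lrshift andbF.
have hkk : h p (X k' p) (X k' p) = p 0 o ^+ 2 * G (rsubmx p) (delta_mx 0 k) (delta_mx 0 k).
  exact: (etrans (fiso p Up _ _) (cone_metric_transverse _ _ _ _)).
have r0 : 0 < p 0 o by move: Up; rewrite /cone_domain /= mxE.
rewrite cone_metric_transverse.
exact: (radial_curvature_bound (fB _ Up) r0 S2 S1 hoo hok hkk (ko_X _ k Up) d0 d1).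
Qed.

(** * The cone over the Heisenberg group *)

Lemma invmx_diagonal (F : fieldType) (m : nat) (M : 'M[F]_m) :
  (forall i j, i != j -> M i j = 0) -> (forall i, M i i != 0) ->
  forall i j, invmx M i j = (i == j)%:R / M i i.
Proof.
move=> M0 Mn0 i j.
pose D : 'M[F]_m := \matrix_(k, l) ((k == l)%:R / M k k).
have MD : M *m D = 1%:M.
  apply/matrixP => k l; rewrite !mxE (bigD1 k)//= big1 => [|a ak].
    rewrite mxE addr0; case: eqP => _; last by rewrite mul0r mulr0.
    by rewrite mul1r divff.
  by rewrite M0 ?mul0r// eq_sym.
have [MU _] := mulmx1_unit MD.
by rewrite -[invmx M]mulmx1 -MD mulKmx// mxE.
Qed.

Lemma heis_metric_origin (R : realType) (a b : 'I_3) :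
  heis_metric (0 : 'rV[R]_3) (delta_mx 0 a) (delta_mx 0 b) =
  if a == b then (if a == 2 then 4^-1 else 1) else 0.
Proof.
rewrite /heis_metric /heis_omega !mxE.
case: a => [[|[|[|//]]]] /= ?; case: b => [[|[|[|//]]]] /= ?; rewrite /eq_op /=; ring.
Qed.

Theorem mainTheorem8 (R : realType) (n : nat) :
  ~ exists f : 'rV[R]_(1 + 3) -> 'rV[R]_(n + n),
    [/\ forall p, cone_domain 3 p -> complex_ball n (f p),
        isometric_immersion (complex_hyperbolic_metric n) f
          (cone_domain 3) (cone_metric heis_metric)
      & minimal (complex_hyperbolic_metric n) f (cone_domain 3)].
Proof.
move=> [f [fB fI fmin]].
pose o : 'I_(1 + 3) := lshift 3 0.
(* The point r = 1 over the origin, where the coordinate frame is orthogonal. *)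
pose p : 'rV[R]_(1 + 3) := delta_mx 0 o.
have Up : cone_domain 3 p by rewrite /cone_domain /= !mxE.
have heis0 (q v : 'rV[R]_3) : heis_metric q 0 v = 0.
  by rewrite /heis_metric /heis_omega !mxE; ring.
have [Vt Vn] := cone_radial_gauss heis0 fB fI Up.
set V := cov_partial _ f _ _ p in Vt Vn.
pose h := complex_hyperbolic_metric n (f p).
have FE i j : first_form (complex_hyperbolic_metric n) f p i j =
    cone_metric heis_metric p (delta_mx 0 i) (delta_mx 0 j).
  by rewrite mxE; exact: (fI.2 _ Up).
have p0 : rsubmx p = 0.
  by apply/rowP => k; rewrite !mxE eq_rlshift andbF.
have Foo : first_form (complex_hyperbolic_metric n) f p o o = 1.
  by rewrite FE cone_metric_radial// mxE !eqxx.
have Fkl (k l : 'I_3) : first_form (complex_hyperbolic_metric n) f p (rshift 1 k) (rshift 1 l) =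
    if k == l then (if k == 2 then 4^-1 else 1) else 0.
  by rewrite FE cone_metric_transverse p0 heis_metric_origin mxE !eqxx expr1n mul1r.
have Fkk (k : 'I_3) : 0 < first_form (complex_hyperbolic_metric n) f p (rshift 1 k) (rshift 1 k).
  by rewrite Fkl eqxx; case: ifP.
have Fn0 i : first_form (complex_hyperbolic_metric n) f p i i != 0.
  have [k ->|k ->] := split_ordP i; last by rewrite gt_eqF.
  by rewrite ord1 Foo oner_neq0.
have F0 i j : i != j -> first_form (complex_hyperbolic_metric n) f p i j = 0.
  have [k ->|k ->] := split_ordP i; have [l ->|l ->] := split_ordP j.
  - by rewrite !ord1 eqxx.
  - by rewrite ord1 FE cone_metric_radial// mxE eq_lrshift andbF.
  - rewrite (ord1 l) [LHS]mxE ch_metricC => _.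
    have := FE o (rshift 1 k); rewrite mxE => ->.
    by rewrite cone_metric_radial// mxE eq_lrshift andbF.
  - by rewrite eq_rshift Fkl => /negbTE ->.
have := minimal_trace (fmin _ Up) Vt.
under eq_bigr => i _.
  rewrite (bigD1 i)//= big1 => [|j ji]; last first.
    by rewrite (invmx_diagonal F0 Fn0) eq_sym (negbTE ji) !mul0r.
  rewrite (invmx_diagonal F0 Fn0) eqxx addr0 mul1r.
  over.
rewrite (@big_split_ord _ _ _ 1 3) /= big_ord1 Foo invr1 mul1r => H.
have pos3 : 0 < \sum_(k < 3) (1 : R) by rewrite sumr_const card_ord.
have le1 : \sum_(k < 3) (1 : R) <= \sum_(k < 3)
    (first_form (complex_hyperbolic_metric n) f p (rshift 1 k) (rshift 1 k))^-1 *
    h V (cov_partial (complex_hyperbolic_metric n) f (rshift 1 k) (rshift 1 k) p).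
  apply: ler_sum => k _; rewrite -ler_pdivrMl ?invr_gt0// invrK mulr1 FE.
  exact: Vn.
have := ltr_wpDl (ch_metric_ge0 V (fB _ Up)) (lt_le_trans pos3 le1).
by move=> /lt_eqF /eqP; apply; exact: esym H.
Qed.
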